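(* Let $A=a_1,a_2,\dots$ be a sequence of positive integers with $a_1\ge 2$ and $A\neq 2,\overline{1}$ (i.e. $A$ is not the sequence $2,1,1,1,\dots$). For $n\in\mathbb{N}$ put \[ \mu_n(A)=[0,a_n,a_{n-1},\dots,a_1]+[a_{n+1},a_{n+2},\dots]. \] Then $\mu_n(A)<3$ for all $n\in\mathbb{N}$ if and only if $A$ has the form \[ 2,1_{2r(1)},2,2,1_{2r(2)},2,2,1_{2r(3)},2,2,\dots \] where $r(1),r(2),\dots$ are nonnegative integers with the properties: (A) $|r(i+1)-r(i)|\le 1$ for all $i$; (B) if $r(i+1)-r(i)$ equals $-1$ (respectively $+1$), then the first of the integers $r(i+j+1)-r(i-j)$, $1\le j<i$, which is not zero is positive (respectively negative); (C$_{01}$) $r(1)\le r(2)$, and if $r(i+1)-r(i)=-1$, then there exists $1\le j<i$ with $r(i+j+1)>r(i-j)$.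
   Context: $[a_0,a_1,\dots]$ denotes a simple continued fraction (finite or infinite) with the given partial quotients; $1_k$ denotes $k$ consecutive terms equal to $1$ (with $1_0$ the empty block); a bar denotes infinite repetition. *)

(* Defs.v *)
From Stdlib Require Import Reals ZArith List.
From Coquelicot Require Import Coquelicot.
Import ListNotations.
Open Scope nat_scope.

(* Sequences are functions on nat indexed from 1, as in a_1, a_2, ...: the
   value at 0 is never used. *)

(* [l_0, l_1, ..., l_m]; the empty list gets the irrelevant value 0. *)
Fixpoint cfrac (l : list nat) : R :=
  match l with
  | [] => 0%R
  | [x] => INR x
  | x :: l' => (INR x + / cfrac l')%R
  end.

(* [b_0, b_1, ...]: the limit of the convergents, which exists and is finite
   whenever b_1, b_2, ... are positive. *)
Definition icfrac (b : nat -> nat) : R :=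
  real (Lim_seq (fun m => cfrac (map b (seq 0 (S m))))).

(* [0, a_n, ..., a_1] + [a_(n+1), a_(n+2), ...].  At n = 0 the first summand
   is [0] = 0. *)
Definition mu (a : nat -> nat) (n : nat) : R :=
  (cfrac (0%nat :: map a (rev (seq 1 n))) + icfrac (fun k => a (n + 1 + k)%nat))%R.

(* The finite word 2, 1_{2r(1)}, 2, 2, ..., 1_{2r(k)}, 2, 2. *)
Definition word (r : nat -> nat) (k : nat) : list nat :=
  2 :: flat_map (fun i => repeat 1 (2 * r i) ++ [2; 2]) (seq 1 k).

(* a_1, a_2, ... is the infinite concatenation
   2, 1_{2r(1)}, 2, 2, 1_{2r(2)}, 2, 2, ...  The words [word r k] have
   unbounded length and each is an initial segment of the next one, so this
   determines a completely. *)
Definition has_form (a r : nat -> nat) : Prop :=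
  forall k, map a (seq 1 (length (word r k))) = word r k.

Definition diff (r : nat -> nat) (m n : nat) : Z :=
  (Z.of_nat (r m) - Z.of_nat (r n))%Z.

(* j is the first index with 1 <= j < i and r(i+j+1) - r(i-j) <> 0. *)
Definition first_nonzero (r : nat -> nat) (i j : nat) : Prop :=
  1 <= j < i /\ diff r (i + j + 1) (i - j) <> 0%Z /\
  forall k, 1 <= k < j -> diff r (i + k + 1) (i - k) = 0%Z.

Definition condA (r : nat -> nat) : Prop :=
  forall i, 1 <= i -> (Z.abs (diff r (i + 1) i) <= 1)%Z.

(* Nothing is required when all of the integers r(i+j+1) - r(i-j),
   1 <= j < i, vanish. *)
Definition condB (r : nat -> nat) : Prop :=
  forall i, 1 <= i ->
    (diff r (i + 1) i = (-1)%Z ->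
       forall j, first_nonzero r i j -> (diff r (i + j + 1) (i - j) > 0)%Z) /\
    (diff r (i + 1) i = 1%Z ->
       forall j, first_nonzero r i j -> (diff r (i + j + 1) (i - j) < 0)%Z).

Definition condC01 (r : nat -> nat) : Prop :=
  r 1 <= r 2 /\
  forall i, 1 <= i -> diff r (i + 1) i = (-1)%Z ->
    exists j, 1 <= j < i /\ r (i + j + 1) > r (i - j).

(* Main.v *)
(* With H_n = [0, a_n, ..., a_1] and T_n = [0, a_n, a_(n+1), ...], all the sums
   mu_n = H_n + a_(n+1) + T_(n+2) are below 3 iff all letters are 1 or 2, none but
   the first is isolated, and at every junction
     P 2 2 1 1 Q  one has  [0, P] > [0, Q],
     P 1 1 2 2 Q  one has  [0, P] < [0, Q]
   (P read leftwards), because 1 - 1 / (1 + 1 / y) = 1 / (1 + y).  Comparing letter by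
   letter, such an inequality next to a block of odd length forces a strictly shorter
   block of odd length beyond the junction, so by descent all blocks are even (apart from
   the initial block of twos, which is odd).  Once the sequence is cut into the blocks
   1_(2 r(i)) 2 2, prefixing by 1 1 and by 2 2 is increasing, with values above resp.
   below 1/2, so the inequalities become lexicographic comparisons of
   r(i+1), r(i+2), ... with r(i), r(i-1), ..., r(1).  When the latter is exhausted, the
   initial letter 2, of value [0, 2] = 1/2, beats every 2 2 ..., which is the
   asymmetry expressed by (C01). *)

Require Import Defs.
From Stdlib Require Import Reals Lra Lia ZArith List Classical ClassicalEpsilon.
From Stdlib Require Import FunctionalExtensionality.
From Coquelicot Require Import Coquelicot.
Import ListNotations.
Open Scope nat_scope.

(* Proves [a n = c] from [H : a m = c] when [n = m] is linear arithmetic. *)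
Ltac same_index H := refine (eq_trans (f_equal _ _) H); lia.

(** * Infinite continued fractions *)

Definition convergent (b : nat -> nat) (m : nat) : R :=
  cfrac (map b (seq 0 (S m))).

Lemma convergent_S (b : nat -> nat) (m : nat) :
  convergent b (S m) = (INR (b 0%nat) + / convergent (fun k => b (S k)) m)%R.
Proof.
  unfold convergent.
  change (seq 0 (S (S m))) with (0 :: seq 1 (S m)).
  rewrite <- seq_shift. simpl. rewrite map_map. reflexivity.
Qed.

Lemma convergent_bounds (b : nat -> nat) (m : nat) :
  (forall k, 1 <= b k) ->
  (INR (b 0%nat) <= convergent b m <= INR (b 0%nat) + 1)%R.
Proof.
  revert b; induction m as [|m IH]; intros b Hb.
  - unfold convergent; simpl; lra.
  - rewrite convergent_S.
    specialize (IH (fun k => b (S k)) (fun k => Hb (S k))).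
    assert (H1 : (1 <= INR (b 1%nat))%R) by (apply (le_INR 1), Hb).
    set (x := convergent (fun k => b (S k)) m) in *. simpl in IH.
    assert (0 < / x)%R by (apply Rinv_0_lt_compat; lra).
    assert (/ x <= / 1)%R by (apply Rinv_le_contravar; lra).
    rewrite Rinv_1 in *. lra.
Qed.

(* Inversion alone is only nonexpansive on [1, oo), but two consecutive steps
   [x = b_0 + 1 / x'] satisfy [x x' = b_0 x' + 1 >= 2], so that they contract by 1/4. *)
Lemma inv_step_contraction (c x y : R) :
  (1 <= c)%R -> (1 <= x)%R -> (1 <= y)%R ->
  (Rabs (/ (c + / x) - / (c + / y)) <= Rabs (x - y) / 4)%R.
Proof.
  intros Hc Hx Hy.
  assert (Hcx : (2 <= c * x + 1)%R) by nra.
  assert (Hcy : (2 <= c * y + 1)%R) by nra.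
  replace (/ (c + / x) - / (c + / y))%R
    with ((x - y) * / ((c * x + 1) * (c * y + 1)))%R by (field; lra).
  rewrite Rabs_mult.
  apply Rmult_le_compat_l; [apply Rabs_pos|].
  assert (4 <= (c * x + 1) * (c * y + 1))%R by nra.
  rewrite Rabs_right by (left; apply Rinv_0_lt_compat; lra).
  apply Rinv_le_contravar; lra.
Qed.

(** Each step strips two partial quotients and gains a factor 1/4 from [inv_step_contraction]. At N
    = 0 both convergents lie in an interval of length 1. *)
Lemma convergent_cauchy (N : nat) (b : nat -> nat) (i j : nat) :
  (forall k, 1 <= b k) ->
  (Rabs (convergent b (2 * N + i) - convergent b (2 * N + j)) <= (/ 4) ^ N)%R.
Proof.
  revert b; induction N as [|N IH]; intros b Hb.
  - pose proof (convergent_bounds b i Hb). pose proof (convergent_bounds b j Hb).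
    simpl. apply Rabs_le. lra.
  - replace (2 * S N + i) with (S (S (2 * N + i))) by lia.
    replace (2 * S N + j) with (S (S (2 * N + j))) by lia.
    rewrite !convergent_S.
    set (b2 := fun k => b (S (S k))).
    assert (Hb2 : forall k, 1 <= b2 k) by (intro; apply Hb).
    specialize (IH b2 Hb2).
    assert (H1 : (1 <= INR (b 1%nat))%R) by (apply (le_INR 1), Hb).
    assert (H2 : (1 <= INR (b2 0%nat))%R) by (apply (le_INR 1), Hb2).
    pose proof (convergent_bounds b2 (2 * N + i) Hb2).
    pose proof (convergent_bounds b2 (2 * N + j) Hb2).
    pose proof (inv_step_contraction (INR (b 1%nat)) (convergent b2 (2 * N + i))
      (convergent b2 (2 * N + j)) ltac:(lra) ltac:(lra) ltac:(lra)) as Hc.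
    match goal with |- (Rabs ?e <= _)%R =>
      replace e with (/ (INR (b 1%nat) + / convergent b2 (2 * N + i)) -
                      / (INR (b 1%nat) + / convergent b2 (2 * N + j)))%R by (fold b2; ring)
    end.
    simpl pow. lra.
Qed.

Lemma icfrac_is_lim (b : nat -> nat) :
  (forall k, 1 <= b k) -> is_lim_seq (convergent b) (icfrac b).
Proof.
  intro Hb. apply Lim_seq_correct', ex_lim_seq_cauchy_corr. intros [eps Heps].
  destruct (pow_lt_1_zero (/ 4) ltac:(rewrite Rabs_right; lra) eps Heps) as [N HN].
  exists (2 * N). intros n m Hn Hm. simpl.
  replace n with (2 * N + (n - 2 * N)) by lia.
  replace m with (2 * N + (m - 2 * N)) by lia.
  apply Rle_lt_trans with ((/ 4) ^ N)%R; [now apply convergent_cauchy|].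
  specialize (HN N (le_n N)). apply Rle_lt_trans with (2 := HN), Rle_abs.
Qed.

Lemma icfrac_bounds (b : nat -> nat) :
  (forall k, 1 <= b k) -> (INR (b 0%nat) <= icfrac b <= INR (b 0%nat) + 1)%R.
Proof.
  intro Hb. pose proof (icfrac_is_lim b Hb) as HL. split.
  - refine (is_lim_seq_le _ _ (Finite (INR (b 0%nat))) _ _ (is_lim_seq_const _) HL).
    intro n; apply (convergent_bounds b n Hb).
  - refine (is_lim_seq_le _ _ _ (Finite (INR (b 0%nat) + 1)) _ HL (is_lim_seq_const _)).
    intro n; apply (convergent_bounds b n Hb).
Qed.

Lemma icfrac_step (b : nat -> nat) :
  (forall k, 1 <= b k) ->
  icfrac b = (INR (b 0%nat) + / icfrac (fun k => b (S k)))%R.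
Proof.
  intro Hb.
  assert (Hb' : forall k, 1 <= b (S k)) by (intro; apply Hb).
  pose proof (icfrac_is_lim (fun k => b (S k)) Hb') as HL.
  pose proof (icfrac_bounds (fun k => b (S k)) Hb') as HB.
  assert (1 <= INR (b 1%nat))%R by (apply (le_INR 1), Hb).
  enough (E : Finite (icfrac b)
              = Finite (INR (b 0%nat) + / icfrac (fun k => b (S k)))) by now injection E.
  rewrite <- (is_lim_seq_unique _ _ (icfrac_is_lim b Hb)).
  apply is_lim_seq_unique. apply is_lim_seq_incr_1.
  apply is_lim_seq_ext with
    (fun m => INR (b 0%nat) + / convergent (fun k => b (S k)) m)%R.
  { intro m. symmetry. apply convergent_S. }
  apply is_lim_seq_plus'; [apply is_lim_seq_const|].
  apply (is_lim_seq_inv _ _ HL).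
  intro H0. injection H0 as H0. simpl in HB. lra.
Qed.

(* [tail a n] is [0, a_n, a_(n+1), ...] and [head a n] is [0, a_n, ..., a_1]. *)
Definition tail (a : nat -> nat) (n : nat) : R :=
  (/ icfrac (fun k => a (n + k)%nat))%R.

Fixpoint head (a : nat -> nat) (n : nat) : R :=
  match n with
  | 0 => 0%R
  | S m => (/ (INR (a (S m)) + head a m))%R
  end.

Lemma cfrac_cons (x : nat) (l : list nat) :
  cfrac (x :: l) = (INR x + cfrac (0%nat :: l))%R.
Proof. destruct l; simpl; lra. Qed.

Lemma cfrac_head (a : nat -> nat) (n : nat) :
  cfrac (0 :: map a (rev (seq 1 n))) = head a n.
Proof.
  induction n as [|n IH]; [reflexivity|].
  rewrite seq_S, rev_app_distr.
  change (rev [1 + n] ++ rev (seq 1 n)) with (S n :: rev (seq 1 n)).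
  change (map a (S n :: rev (seq 1 n))) with (a (S n) :: map a (rev (seq 1 n))).
  change (head a (S n)) with (/ (INR (a (S n)) + head a n))%R.
  rewrite <- IH, <- cfrac_cons.
  change (INR 0 + / cfrac (a (S n) :: map a (rev (seq 1 n))) =
          / cfrac (a (S n) :: map a (rev (seq 1 n))))%R.
  simpl INR. ring.
Qed.

Section PositiveSequence.
Context (a : nat -> nat) (Ha : forall n, 1 <= n -> 1 <= a n).

Lemma tail_step (n : nat) :
  1 <= n -> tail a n = (/ (INR (a n) + tail a (S n)))%R.
Proof.
  intro Hn. unfold tail. rewrite icfrac_step by (intro; apply Ha; lia).
  rewrite Nat.add_0_r. do 4 f_equal.
  apply functional_extensionality. intro; f_equal; lia.
Qed.

Lemma INR_a_ge (n : nat) : 1 <= n -> (1 <= INR (a n))%R.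
Proof. intro Hn. apply (le_INR 1), Ha, Hn. Qed.

Lemma tail_bounds (n : nat) : 1 <= n -> (0 < tail a n < 1)%R.
Proof.
  assert (Hpos : forall m, 1 <= m -> (0 < tail a m)%R).
  { intros m Hm. apply Rinv_0_lt_compat.
    pose proof (icfrac_bounds (fun k => a (m + k)) ltac:(intro; apply Ha; lia)) as HB.
    simpl in HB. rewrite Nat.add_0_r in HB. pose proof (INR_a_ge m Hm). lra. }
  intro Hn. split; [now apply Hpos|].
  rewrite tail_step by assumption.
  pose proof (INR_a_ge n Hn). pose proof (Hpos (S n) ltac:(lia)).
  rewrite <- Rinv_1. apply Rinv_lt_contravar; lra.
Qed.

Context (Ha1 : 2 <= a 1).

Lemma head_1_le : (0 < head a 1 <= 1 / 2)%R.
Proof.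
  simpl. pose proof (le_INR 2 _ Ha1) as H. simpl in H. rewrite Rplus_0_r.
  split; [apply Rinv_0_lt_compat; lra|].
  replace (1 / 2)%R with (/ 2)%R by lra. apply Rinv_le_contravar; lra.
Qed.

(** The bound on [a 1] enters at n = 1, where [0, 1] would equal 1; afterwards the positivity of the
    previous value gives the strict upper bound. *)
Lemma head_bounds_pos (n : nat) : 1 <= n -> (0 < head a n < 1)%R.
Proof.
  induction n as [|[|n] IH]; intro Hn; [lia| |].
  - pose proof head_1_le. lra.
  - specialize (IH ltac:(lia)). pose proof (INR_a_ge (S (S n)) ltac:(lia)).
    change (head a (S (S n))) with (/ (INR (a (S (S n))) + head a (S n)))%R.
    split; [apply Rinv_0_lt_compat; lra|].
    rewrite <- Rinv_1. apply Rinv_lt_contravar; lra.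
Qed.

Lemma head_bounds (n : nat) : (0 <= head a n < 1)%R.
Proof.
  destruct n; [simpl; lra|]. pose proof (head_bounds_pos (S n) ltac:(lia)). lra.
Qed.

Lemma mu_decomp (n : nat) :
  mu a n = (head a n + INR (a (S n)) + tail a (S (S n)))%R.
Proof.
  unfold mu. rewrite cfrac_head, icfrac_step by (intro; apply Ha; lia).
  unfold tail. rewrite Rplus_assoc. do 3 f_equal; [f_equal; lia|].
  do 2 f_equal. apply functional_extensionality. intro; f_equal; lia.
Qed.


(** * Local conditions *)

Lemma Rinv_lt_iff (x y : R) : (0 < x)%R -> (0 < y)%R -> (/ x < / y <-> y < x)%R.
Proof.
  intros Hx Hy. split; intro H.
  - rewrite <- (Rinv_inv x), <- (Rinv_inv y).
    apply Rinv_lt_contravar; [|assumption].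
    apply Rmult_lt_0_compat; now apply Rinv_0_lt_compat.
  - apply Rinv_lt_contravar; [nra|assumption].
Qed.

Lemma head_S (n : nat) : head a (S n) = (/ (INR (a (S n)) + head a n))%R.
Proof. reflexivity. Qed.

(** The common first letter cancels and the inversion reverses the order. *)
Lemma tail_lt_head_iff (p q : nat) :
  1 <= p -> a p = a (S q) ->
  (tail a p < head a (S q) <-> head a q < tail a (S p))%R.
Proof.
  intros Hp E. rewrite tail_step, head_S, E by assumption.
  pose proof (INR_a_ge (S q) ltac:(lia)).
  pose proof (tail_bounds (S p) ltac:(lia)). pose proof (head_bounds q).
  rewrite Rinv_lt_iff by lra. lra.
Qed.

Lemma head_lt_tail_iff (p q : nat) :
  1 <= p -> a p = a (S q) ->
  (head a (S q) < tail a p <-> tail a (S p) < head a q)%R.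
Proof.
  intros Hp E. rewrite tail_step, head_S, E by assumption.
  pose proof (INR_a_ge (S q) ltac:(lia)).
  pose proof (tail_bounds (S p) ltac:(lia)). pose proof (head_bounds q).
  rewrite Rinv_lt_iff by lra. lra.
Qed.

(** The remainders lie in [0, 1), so distinct first letters decide, the larger letter giving the
    smaller value. *)
Lemma head_lt_tail (p q : nat) :
  1 <= p -> a p < a (S q) -> (head a (S q) < tail a p)%R.
Proof.
  intros Hp E. rewrite tail_step, head_S by assumption.
  pose proof (INR_a_ge p Hp). pose proof (le_INR _ _ E) as E'. rewrite S_INR in E'.
  pose proof (tail_bounds (S p) ltac:(lia)). pose proof (head_bounds q).
  rewrite Rinv_lt_iff by lra. lra.
Qed.

Lemma tail_lt_head (p q : nat) :
  1 <= p -> a (S q) < a p -> (tail a p < head a (S q))%R.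
Proof.
  intros Hp E. rewrite tail_step, head_S by assumption.
  pose proof (INR_a_ge (S q) ltac:(lia)).
  pose proof (le_INR _ _ E) as E'. rewrite S_INR in E'.
  pose proof (tail_bounds (S p) ltac:(lia)). pose proof (head_bounds q).
  rewrite Rinv_lt_iff by lra. lra.
Qed.

(* The conditions that [mu a n < 3] imposes on the letters around [a_(n+1) = 2]. *)
Record admissible : Prop := {
  adm_letter : forall n, 1 <= n -> a n = 1 \/ a n = 2;
  adm_double : forall n, 1 <= n -> a n = 1 -> a (n + 1) = 2 -> a (n + 2) = 2;
  adm_right : forall n, a (n + 1) = 2 -> a (n + 2) = 2 -> a (n + 3) = 1 ->
    a (n + 4) = 1 /\ (tail a (n + 5) < head a n)%R;
  adm_left : forall n, a (n + 2) = 1 -> a (n + 3) = 2 -> a (n + 4) = 2 ->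
    a (n + 1) = 1 /\ (head a n < tail a (n + 5))%R }.

(* Since [1 - 1 / (1 + 1 / y) = 1 / (1 + y)]. *)
Lemma inv_sum_lt_1_iff (x y : R) :
  (0 <= x)%R -> (0 < y)%R ->
  (/ (2 + x) + / (1 + / y) < 1 <-> y < 1 + x)%R.
Proof.
  intros Hx Hy.
  replace (/ (1 + / y))%R with (1 - / (1 + y))%R by (field; lra).
  pose proof (Rinv_lt_iff (2 + x) (1 + y) ltac:(lra) ltac:(lra)). lra.
Qed.

(** Apply [inv_sum_lt_1_iff] with x = [head a n] and y = [a_(n+4), a_(n+5), ...]: as 1 + x < 2, the
    inequality y < 1 + x forces a_(n+4) = 1, which then cancels. *)
Lemma lt_3_right_iff (n : nat) :
  a (n + 1) = 2 -> a (n + 2) = 2 -> a (n + 3) = 1 ->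
  ((mu a (n + 1) < 3)%R <->
   a (n + 4) = 1 /\ (tail a (n + 5) < head a n)%R).
Proof.
  rewrite mu_decomp.
  replace (S (n + 1)) with (n + 2) by lia. replace (S (n + 2)) with (n + 3) by lia.
  intros E1 E2 E3. rewrite E2, tail_step, E3, (tail_step (S (n + 3))) by lia.
  replace (S (n + 3)) with (n + 4) by lia. replace (S (n + 4)) with (n + 5) by lia.
  replace (n + 1) with (S n) in * by lia. rewrite head_S, E1.
  pose proof (INR_a_ge (n + 4) ltac:(lia)).
  pose proof (tail_bounds (n + 5) ltac:(lia)). pose proof (head_bounds n).
  pose proof (inv_sum_lt_1_iff (head a n) (INR (a (n + 4)) + tail a (n + 5))
    ltac:(lra) ltac:(lra)).
  simpl INR in *. replace (1 + 1)%R with 2%R by lra.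
  destruct (Nat.eq_dec (a (n + 4)) 1) as [E|E].
  - rewrite E in *. simpl INR in *. split; [intro; split; [trivial|]|intros [_ ?]]; lra.
  - pose proof (Ha (n + 4) ltac:(lia)).
    pose proof (le_INR 2 (a (n + 4)) ltac:(lia)). simpl INR in *.
    split; [intro; exfalso; lra|intros [? _]; lia].
Qed.

(** Mirror image of [lt_3_right_iff]: x is now the tail beyond 2 2, and y =
    [a_(n+1), a_n, ..., a_1]. *)
Lemma lt_3_left_iff (n : nat) :
  a (n + 2) = 1 -> a (n + 3) = 2 -> a (n + 4) = 2 ->
  ((mu a (n + 2) < 3)%R <->
   a (n + 1) = 1 /\ (head a n < tail a (n + 5))%R).
Proof.
  rewrite mu_decomp.
  replace (S (n + 2)) with (n + 3) by lia. replace (S (n + 3)) with (n + 4) by lia.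
  intros E1 E2 E3. rewrite E2, tail_step, E3 by lia.
  replace (S (n + 4)) with (n + 5) by lia.
  replace (n + 2) with (S (S n)) in * by lia. rewrite head_S, E1, head_S.
  replace (n + 1) with (S n) in * by lia.
  pose proof (INR_a_ge (S n) ltac:(lia)).
  pose proof (tail_bounds (n + 5) ltac:(lia)). pose proof (head_bounds n).
  pose proof (inv_sum_lt_1_iff (tail a (n + 5)) (INR (a (S n)) + head a n)
    ltac:(lra) ltac:(lra)).
  simpl (INR 1) in *. simpl (INR 2) in *. replace (1 + 1)%R with 2%R by lra.
  destruct (Nat.eq_dec (a (S n)) 1) as [E|E].
  - rewrite E in *. simpl INR in *. split; [intro; split; [trivial|]|intros [_ ?]]; lra.
  - pose proof (Ha (S n) ltac:(lia)).
    pose proof (le_INR 2 (a (S n)) ltac:(lia)). simpl (INR 2) in *.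
    split; [intro; exfalso; lra|intros [? _]; lia].
Qed.

Lemma head_gt_half (n : nat) : a (S n) = 1 -> (1 / 2 < head a (S n))%R.
Proof.
  intro E. rewrite head_S, E. simpl INR. pose proof (head_bounds n).
  replace (1 / 2)%R with (/ 2)%R by lra. apply Rinv_lt_contravar; lra.
Qed.

Lemma tail_gt_half (n : nat) : 1 <= n -> a n = 1 -> (1 / 2 < tail a n)%R.
Proof.
  intros Hn E. rewrite tail_step, E by assumption. simpl INR.
  pose proof (tail_bounds (S n) ltac:(lia)).
  replace (1 / 2)%R with (/ 2)%R by lra. apply Rinv_lt_contravar; lra.
Qed.

Lemma head_le_half (n : nat) : a (S n) = 2 -> (head a (S n) <= 1 / 2)%R.
Proof.
  intro E. rewrite head_S, E. simpl INR. pose proof (head_bounds n).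
  replace (1 / 2)%R with (/ 2)%R by lra. apply Rinv_le_contravar; lra.
Qed.

Lemma tail_lt_half (n : nat) : 1 <= n -> a n = 2 -> (tail a n < 1 / 2)%R.
Proof.
  intros Hn E. rewrite tail_step, E by assumption. simpl INR.
  pose proof (tail_bounds (S n) ltac:(lia)).
  replace (1 / 2)%R with (/ 2)%R by lra. apply Rinv_lt_contravar; lra.
Qed.

Lemma lt_3_iff_admissible : (forall n, (mu a n < 3)%R) <-> admissible.
Proof.
  split.
  - intro Hmu.
    assert (Hletter : forall n, 1 <= n -> a n = 1 \/ a n = 2).
    { intros n Hn. destruct n as [|n]; [lia|]. specialize (Hmu n).
      rewrite mu_decomp in Hmu.
      pose proof (head_bounds n). pose proof (tail_bounds (S (S n)) ltac:(lia)).
      pose proof (Ha (S n) Hn).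
      destruct (le_lt_dec 3 (a (S n))) as [H3|]; [|lia].
      pose proof (le_INR _ _ H3). simpl INR in *. lra. }
    split; [assumption| | |].
    (* An isolated 2 would have a 1 on both sides, each side contributing more than 1/2. *)
    + intros n Hn E1 E2. destruct (Hletter (n + 2) ltac:(lia)) as [E3|]; [exfalso|assumption].
      specialize (Hmu n). rewrite mu_decomp in Hmu.
      replace (S n) with (n + 1) in Hmu by lia. rewrite E2 in Hmu.
      replace (S (n + 1)) with (n + 2) in Hmu by lia.
      pose proof (tail_gt_half (n + 2) ltac:(lia) E3).
      destruct n as [|n]; [lia|]. pose proof (head_gt_half n E1).
      simpl INR in Hmu. lra.
    + intros n E1 E2 E3. now apply lt_3_right_iff.
    + intros n E1 E2 E3. now apply lt_3_left_iff.
  - intros [Hletter Hdouble Hright Hleft] n.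
    pose proof (head_bounds n). pose proof (tail_bounds (S (S n)) ltac:(lia)).
    destruct (Hletter (S n) ltac:(lia)) as [E|E].
    { rewrite mu_decomp, E. simpl INR. lra. }
    destruct n as [|n]; [rewrite mu_decomp, E; simpl in *; lra|].
    destruct (Hletter (S n) ltac:(lia)) as [E1|E1];
      destruct (Hletter (S (S (S n))) ltac:(lia)) as [E2|E2].
    + specialize (Hdouble (S n) ltac:(lia) E1). simpl in Hdouble.
      replace (n + 1) with (S n) in Hdouble by lia.
      replace (n + 2) with (S (S n)) in Hdouble by lia.
      specialize (Hdouble E). lia.
    + destruct n as [|n]; [lia|].
      replace (S (S n)) with (n + 2) in * by lia.
      replace (S (n + 2)) with (n + 3) in * by lia.
      replace (S (n + 3)) with (n + 4) in * by lia.
      apply lt_3_left_iff; auto.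
    + replace (S n) with (n + 1) in * by lia.
      replace (S (n + 1)) with (n + 2) in * by lia.
      replace (S (n + 2)) with (n + 3) in * by lia.
      apply lt_3_right_iff; auto.
    + rewrite mu_decomp, E. simpl INR.
      pose proof (head_le_half n E1).
      pose proof (tail_lt_half (S (S (S n))) ltac:(lia) E2). lra.
Qed.

(** * Parity of the blocks *)

Context (Hadm : admissible).

(** The leftward reading starts with 2k+1 ones and a 2. At odd places the larger tail must show a 1;
    at even places a 2 decides in its favour and closes an odd block. Without such a 2 the final
    comparison, 1 against 2, would make the tail smaller. *)
Lemma shorter_ones (k p q : nat) :
  1 <= p -> 1 <= q -> a q = 2 -> (forall i, i < 2 * k + 1 -> a (q + 1 + i) = 1) ->
  (head a (q + 2 * k + 1) < tail a p)%R ->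
  exists j, j <= k /\ (forall i, i < 2 * j + 1 -> a (p + i) = 1) /\
    a (p + 2 * j + 1) = 2.
Proof.
  revert p; induction k as [|k IH]; intros p Hp Hq Eq Hones Hlt.
  all: match type of Hlt with (head a (?e + 1) < _)%R =>
         replace (e + 1) with (S e) in Hlt by lia;
         assert (E0 : a (S e) = 1)
           by (same_index (Hones (e - q) ltac:(lia)))
       end.
  all: destruct (adm_letter Hadm p Hp) as [Ep|Ep];
    [|exfalso; apply (Rlt_asym _ _ Hlt), tail_lt_head; lia].
  all: apply head_lt_tail_iff in Hlt; [|lia|lia].
  all: destruct (adm_letter Hadm (S p) ltac:(lia)) as [Ep1|Ep1].
  2, 4: exists 0; split; [lia|]; split;
    [intros i Hi; same_index Ep|same_index Ep1].
  - exfalso. apply (Rlt_asym _ _ Hlt).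
    replace (q + 2 * 0) with (S (q - 1)) by lia. apply head_lt_tail; [lia|].
    replace (S (q - 1)) with q by lia. lia.
  - replace (q + 2 * S k) with (S (q + 2 * k + 1)) in Hlt by lia.
    apply tail_lt_head_iff in Hlt; [|lia|].
    2: { rewrite Ep1. symmetry. same_index (Hones (2 * k + 1) ltac:(lia)). }
    destruct (IH (S (S p)) ltac:(lia) Hq Eq ltac:(intros; apply Hones; lia) Hlt)
      as (j & Hj & H1 & H2).
    exists (S j). split; [lia|]. split.
    + intros [|[|i]] Hi.
      * same_index Ep.
      * same_index Ep1.
      * same_index (H1 i ltac:(lia)).
    + same_index H2.
Qed.

(** The argument of [shorter_ones] with the letters 1 and 2 exchanged and the inequality
    reversed. *)
Lemma shorter_twos (k p q : nat) :
  1 <= p -> 1 <= q -> a q = 1 -> (forall i, i < 2 * k + 1 -> a (q + 1 + i) = 2) ->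
  (tail a p < head a (q + 2 * k + 1))%R ->
  exists j, j <= k /\ (forall i, i < 2 * j + 1 -> a (p + i) = 2) /\
    a (p + 2 * j + 1) = 1.
Proof.
  revert p; induction k as [|k IH]; intros p Hp Hq Eq Htwos Hlt.
  all: match type of Hlt with (_ < head a (?e + 1))%R =>
         replace (e + 1) with (S e) in Hlt by lia;
         assert (E0 : a (S e) = 2)
           by (same_index (Htwos (e - q) ltac:(lia)))
       end.
  all: destruct (adm_letter Hadm p Hp) as [Ep|Ep];
    [exfalso; apply (Rlt_asym _ _ Hlt), head_lt_tail; lia|].
  all: apply tail_lt_head_iff in Hlt; [|lia|lia].
  all: destruct (adm_letter Hadm (S p) ltac:(lia)) as [Ep1|Ep1].
  1, 3: exists 0; split; [lia|]; split;
    [intros i Hi; same_index Ep|same_index Ep1].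
  - exfalso. apply (Rlt_asym _ _ Hlt).
    replace (q + 2 * 0) with (S (q - 1)) by lia. apply tail_lt_head; [lia|].
    replace (S (q - 1)) with q by lia. lia.
  - replace (q + 2 * S k) with (S (q + 2 * k + 1)) in Hlt by lia.
    apply head_lt_tail_iff in Hlt; [|lia|].
    2: { rewrite Ep1. symmetry. same_index (Htwos (2 * k + 1) ltac:(lia)). }
    destruct (IH (S (S p)) ltac:(lia) Hq Eq ltac:(intros; apply Htwos; lia) Hlt)
      as (j & Hj & H1 & H2).
    exists (S j). split; [lia|]. split.
    + intros [|[|i]] Hi.
      * same_index Ep.
      * same_index Ep1.
      * same_index (H1 i ltac:(lia)).
    + same_index H2.
Qed.

(** The same alternation against a reading of 2k twos only. Once it is used up the rest is
    [head a 0] = 0, which exceeds no tail, so a 1 must come earlier, at an even place. *)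
Lemma odd_twos_after_initial_twos (k p : nat) :
  1 <= p -> (forall i, i < 2 * k -> a (1 + i) = 2) ->
  (tail a p < head a (2 * k))%R ->
  exists j, (forall i, i < 2 * j + 1 -> a (p + i) = 2) /\ a (p + 2 * j + 1) = 1.
Proof.
  revert p; induction k as [|k IH]; intros p Hp Htwos Hlt.
  { pose proof (tail_bounds p Hp). simpl in Hlt. lra. }
  replace (2 * S k) with (S (S (2 * k))) in Hlt by lia.
  assert (Ek : a (S (2 * k)) = 2) by (apply (Htwos (2 * k)); lia).
  assert (Ek1 : a (S (S (2 * k))) = 2) by (apply (Htwos (S (2 * k))); lia).
  destruct (adm_letter Hadm p Hp) as [Ep|Ep].
  { exfalso. apply (Rlt_asym _ _ Hlt), head_lt_tail; [lia|].
    lia. }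
  apply tail_lt_head_iff in Hlt; [|lia|lia].
  destruct (adm_letter Hadm (S p) ltac:(lia)) as [Ep1|Ep1].
  { exists 0; split;
    [intros i Hi; same_index Ep|same_index Ep1]. }
  apply head_lt_tail_iff in Hlt; [|lia|lia].
  destruct (IH (S (S p)) ltac:(lia) ltac:(intros; apply Htwos; lia) Hlt)
    as (j & H1 & H2).
  exists (S j). split.
  - intros [|[|i]] Hi.
    + same_index Ep.
    + same_index Ep1.
    + same_index (H1 i ltac:(lia)).
  - same_index H2.
Qed.

(** Here the tail is known and the leftward reading is not. Its first 2 cannot be at an odd place,
    as this would make it the smaller one. It cannot consist of ones only, since it would leave
    [head a 0] = 0 or meet a_1 = 1. *)
Lemma odd_ones_before_ones_forever (q p : nat) :
  1 <= p -> (forall i, p <= i -> a i = 1) -> (tail a p < head a q)%R ->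
  exists k n, q = n + 2 * k + 1 /\ 1 <= n /\ a n = 2 /\
    forall i, i < 2 * k + 1 -> a (n + 1 + i) = 1.
Proof.
  revert p; induction q as [q IH] using (well_founded_induction Wf_nat.lt_wf).
  intros p Hp Hones Hlt.
  destruct q as [|q].
  { pose proof (tail_bounds p Hp). simpl in Hlt. lra. }
  destruct (adm_letter Hadm (S q) ltac:(lia)) as [E|E].
  2: { exfalso. apply (Rlt_asym _ _ Hlt), head_lt_tail; [lia|].
       rewrite Hones; lia. }
  destruct q as [|q]; [lia|].
  apply tail_lt_head_iff in Hlt; [|lia|rewrite Hones; lia].
  destruct (adm_letter Hadm (S q) ltac:(lia)) as [E1|E1].
  - apply head_lt_tail_iff in Hlt; [|lia|rewrite Hones; lia].
    destruct (IH q ltac:(lia) (S (S p)) ltac:(lia) ltac:(intros; apply Hones; lia) Hlt)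
      as (k & n & Eq & Hn & En & H1).
    exists (S k), n. repeat split; [lia|lia|assumption|].
    intros i Hi. destruct (le_lt_dec (2 * k + 1) i) as [Hge|]; [|now apply H1].
    assert (i = 2 * k + 1 \/ i = 2 * k + 2) as [->| ->] by lia.
    + same_index E1.
    + same_index E.
  - exists 0, (S q). repeat split; [lia|lia|assumption|].
    intros i Hi. same_index E.
Qed.

(* An odd block of ones between twos is followed by another one, strictly shorter. *)
Lemma no_odd_ones (k n : nat) :
  1 <= n -> a n = 2 -> (forall i, i < 2 * k + 1 -> a (n + 1 + i) = 1) ->
  a (n + 2 * k + 2) = 2 -> False.
Proof.
  revert n; induction k as [k IH] using (well_founded_induction Wf_nat.lt_wf).
  intros n Hn E Hones E2.
  assert (E1 : a (n + 2 * k + 1) = 1)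
    by (same_index (Hones (2 * k) ltac:(lia))).
  assert (E3 : a (n + 2 * k + 3) = 2).
  { replace (n + 2 * k + 3) with (n + 2 * k + 1 + 2) by lia.
    apply (adm_double Hadm); [lia|assumption|].
    same_index E2. }
  destruct (adm_left Hadm (n + 2 * k - 1)) as [E0 Hlt].
  1: same_index E1.
  1: same_index E2.
  1: same_index E3.
  (* For a single 1, [adm_left] asks for another 1 where a_n = 2 stands. *)
  destruct k as [|k].
  { replace (n + 2 * 0 - 1 + 1) with n in E0 by lia. lia. }
  (* The junction uses up the last two ones, leaving an odd block to be read leftwards. *)
  replace (n + 2 * S k - 1) with (n + 2 * k + 1) in Hlt by lia.
  destruct (shorter_ones k (n + 2 * k + 1 + 5) n) as (j & Hj & H1 & H2);
    [lia|assumption|assumption|intros; apply Hones; lia|assumption|].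
  apply (IH j ltac:(lia) (n + 2 * S k + 3)); [lia|assumption| |].
  - intros i Hi. same_index (H1 i Hi).
  - same_index H2.
Qed.

(** The descent of [no_odd_ones], now at a junction 2 2 1 1; a single 2 is excluded by
    [adm_double]. *)
Lemma no_odd_twos (k n : nat) :
  1 <= n -> a n = 1 -> (forall i, i < 2 * k + 1 -> a (n + 1 + i) = 2) ->
  a (n + 2 * k + 2) = 1 -> False.
Proof.
  revert n; induction k as [k IH] using (well_founded_induction Wf_nat.lt_wf).
  intros n Hn E Htwos E2.
  destruct k as [|k].
  { pose proof (adm_double Hadm n Hn E) as H. replace (n + 2) with (n + 2 * 0 + 2) in H by lia.
    rewrite E2 in H. discriminate H. same_index (Htwos 0 ltac:(lia)). }
  destruct (adm_right Hadm (n + 2 * k + 1)) as [E0 Hlt].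
  1: same_index (Htwos (2 * k + 1) ltac:(lia)).
  1: same_index (Htwos (2 * k + 2) ltac:(lia)).
  1: same_index E2.
  destruct (shorter_twos k (n + 2 * k + 1 + 5) n) as (j & Hj & H1 & H2);
    [lia|assumption|assumption|intros; apply Htwos; lia|assumption|].
  apply (IH j ltac:(lia) (n + 2 * k + 1 + 4)); [lia|assumption| |].
  - intros i Hi. same_index (H1 i Hi).
  - same_index H2.
Qed.

(** The junction leaves 2k twos down to a_1, so an odd block of twos between ones would follow it,
    against [no_odd_twos]. *)
Lemma no_even_initial_twos (k : nat) :
  (forall i, i < 2 * k + 2 -> a (1 + i) = 2) -> a (2 * k + 3) = 1 -> False.
Proof.
  intros Htwos E.
  destruct (adm_right Hadm (2 * k)) as [E0 Hlt].
  1: same_index (Htwos (2 * k) ltac:(lia)).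
  1: same_index (Htwos (2 * k + 1) ltac:(lia)).
  1: assumption.
  destruct (odd_twos_after_initial_twos k (2 * k + 5)) as (j & H1 & H2);
    [lia|intros; apply Htwos; lia|assumption|].
  apply (no_odd_twos j (2 * k + 4)); [lia|assumption| |].
  - intros i Hi. same_index (H1 i Hi).
  - same_index H2.
Qed.

(** The junction before the ones would produce an odd block of ones further left, lying between
    twos. *)
Lemma no_ones_forever (n : nat) :
  a (n + 1) = 2 -> a (n + 2) = 2 -> (forall i, n + 3 <= i -> a i = 1) -> False.
Proof.
  intros E1 E2 Hones.
  destruct (adm_right Hadm n E1 E2 (Hones _ (le_n _))) as [_ Hlt].
  destruct (odd_ones_before_ones_forever n (n + 5)) as (k & m & Em & Hm & E & H1);
    [lia|intros; apply Hones; lia|assumption|].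
  apply (no_odd_ones k m Hm E H1). same_index E1.
Qed.

(* [e] is the end of a maximal block of twos as far as the letters up to [a_e] can
   tell: odd if it starts the sequence, even and nonempty otherwise. *)
Definition twos_boundary (e : nat) : Prop :=
  exists m s, e = m + s /\ (forall i, i < s -> a (m + 1 + i) = 2) /\
    ((m = 0 /\ exists k, s = 2 * k + 1) \/
     (1 <= m /\ a m = 1 /\ exists k, s = 2 * k + 2)).

Lemma first_not_one (p : nat) :
  (exists n, a (p + n) <> 1) ->
  exists n, a (p + n) <> 1 /\ forall k, k < n -> a (p + k) = 1.
Proof.
  intros [n Hn]. induction n as [n IH] using (well_founded_induction Wf_nat.lt_wf).
  destruct (classic (exists k, k < n /\ a (p + k) <> 1)) as [(k & Hk & Ek)|H].
  - now apply (IH k).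
  - exists n. split; [assumption|]. intros k Hk.
    apply NNPP. intro Ek. apply H. now exists k.
Qed.

(** The invariant [twos_boundary] remembers the parity of the current run of twos. If a 1 comes
    next, the run of ones must end and be even; if a 2 comes next, that parity forces a second 2,
    and the block of ones is empty. *)
Lemma next_block (e : nat) :
  ~ (a 1 = 2 /\ forall n, 2 <= n -> a n = 1) ->
  twos_boundary e ->
  exists r, (forall k, k < 2 * r -> a (e + 1 + k) = 1) /\
    a (e + 2 * r + 1) = 2 /\ a (e + 2 * r + 2) = 2 /\
    twos_boundary (e + 2 * r + 2).
Proof.
  intros Hnot (m & s & -> & Htwos & Hm).
  assert (Hs : 1 <= s) by (destruct Hm as [[_ [k ->]]|[_ [_ [k ->]]]]; lia).
  assert (Ee : a (m + s) = 2) by same_index (Htwos (s - 1) ltac:(lia)).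
  destruct (adm_letter Hadm (m + s + 1) ltac:(lia)) as [E1|E1].
  - destruct (first_not_one (m + s + 1)) as (n & En & Hones).
    { apply not_all_ex_not. intro Hall.
      assert (Hones : forall i, m + s + 1 <= i -> a i = 1).
      { intros i Hi. same_index (Hall (i - (m + s + 1))). }
      destruct (Nat.eq_dec (m + s) 1) as [E|E].
      (* This is the sequence 2, 1, 1, ..., excluded by hypothesis. *)
      - apply Hnot. split; [same_index Ee|]. intros; apply Hones; lia.
      - assert (2 <= s) by (destruct Hm as [[-> [k ->]]|[_ [_ [k ->]]]]; lia).
        apply (no_ones_forever (m + s - 2)).
        + same_index (Htwos (s - 2) ltac:(lia)).
        + same_index (Htwos (s - 1) ltac:(lia)).
        + intros; apply Hones; lia. }
    assert (En2 : a (m + s + 1 + n) = 2)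
      by (destruct (adm_letter Hadm (m + s + 1 + n) ltac:(lia)); [contradiction|assumption]).
    destruct (Nat.Even_or_Odd n) as [[r ->]|[k ->]].
    + destruct r as [|r]; [exfalso; replace (m + s + 1 + 2 * 0) with (m + s + 1) in En2; lia|].
      exists (S r). split; [assumption|].
      assert (F1 : a (m + s + 2 * S r + 1) = 2) by same_index En2.
      assert (F2 : a (m + s + 2 * S r + 2) = 2).
      { apply (adm_double Hadm); [lia| |assumption].
        same_index (Hones (2 * r + 1) ltac:(lia)). }
      repeat split; [assumption|assumption|].
      exists (m + s + 2 * S r), 2. split; [lia|]. split.
      * intros [|[|i]] Hi; [same_index F1|same_index F2|lia].
      * right. split; [lia|]. split; [|exists 0; lia].
        same_index (Hones (2 * r + 1) ltac:(lia)).
    + exfalso. apply (no_odd_ones k (m + s)); [lia|assumption| |same_index En2].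
      intros; now apply Hones.
  - assert (E2 : a (m + s + 2) = 2).
    { destruct (adm_letter Hadm (m + s + 2) ltac:(lia)) as [E2|]; [exfalso|assumption].
      (* A 1 after this 2 would end a run of s + 1 twos, of the forbidden parity. *)
      assert (Htwos' : forall i, i < s + 1 -> a (m + 1 + i) = 2).
      { intros i Hi. destruct (Nat.eq_dec i s) as [->|]; [same_index E1|].
        apply Htwos; lia. }
      destruct Hm as [[-> [k ->]]|[Hm [Em [k ->]]]].
      - apply (no_even_initial_twos k); [|same_index E2].
        intros i Hi. same_index (Htwos' i ltac:(lia)).
      - apply (no_odd_twos (k + 1) m); [assumption|assumption| |same_index E2].
        intros i Hi. apply Htwos'. lia. }
    exists 0. split; [intros; lia|]. split; [same_index E1|]. split; [same_index E2|].
    exists m, (s + 2). split; [lia|]. split.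
    + intros i Hi. destruct (le_lt_dec s i); [|now apply Htwos].
      assert (i = s \/ i = s + 1) as [->| ->] by lia; [same_index E1|same_index E2].
    + destruct Hm as [[-> [k ->]]|[Hm [Em [k ->]]]].
      * left. split; [reflexivity|]. exists (k + 1). lia.
      * right. repeat split; try assumption. exists (k + 1). lia.
Qed.

End PositiveSequence.

(** * Positions of the blocks *)

Fixpoint block_end (r : nat -> nat) (i : nat) : nat :=
  match i with
  | 0 => 1
  | S j => block_end r j + 2 * r (S j) + 2
  end.

(** [has_form] by positions instead of words: [block_end r i] is the length of [word r i], the
    position of the 2 that ends it. *)
Definition block_form (a r : nat -> nat) : Prop :=
  a 1 = 2 /\
  forall i,
    (forall k, k < 2 * r (S i) -> a (block_end r i + 1 + k) = 1) /\
    a (block_end r i + 2 * r (S i) + 1) = 2 /\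
    a (block_end r i + 2 * r (S i) + 2) = 2.

Lemma word_S (r : nat -> nat) (k : nat) :
  word r (S k) = word r k ++ repeat 1 (2 * r (S k)) ++ [2; 2].
Proof.
  unfold word. rewrite seq_S, flat_map_app. simpl flat_map.
  rewrite app_nil_r. reflexivity.
Qed.

Lemma length_word (r : nat -> nat) (k : nat) : length (word r k) = block_end r k.
Proof.
  induction k as [|k IH]; [reflexivity|].
  rewrite word_S, !length_app, repeat_length, IH. simpl. lia.
Qed.

Lemma map_seq_ones_two_two (a : nat -> nat) (n s : nat) :
  map a (seq s (n + 2)) = repeat 1 n ++ [2; 2] <->
  (forall k, k < n -> a (s + k) = 1) /\ a (s + n) = 2 /\ a (s + n + 1) = 2.
Proof.
  revert s; induction n as [|n IH]; intro s; simpl.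
  - replace (s + 0) with s by lia. replace (s + 1) with (S s) by lia. split.
    + intro H. injection H as -> ->. split; [intros; lia|]. now split.
    + intros [_ [-> ->]]. reflexivity.
  - replace (s + S n) with (S s + n) by lia. split.
    + intro H. injection H as H0 H. apply IH in H as [H1 H2].
      split; [|exact H2]. intros [|k] Hk; [same_index H0|].
      same_index (H1 k ltac:(lia)).
    + intros [H1 H2]. f_equal; [same_index (H1 0 ltac:(lia))|].
      apply IH. split; [|exact H2]. intros k Hk. same_index (H1 (S k) ltac:(lia)).
Qed.

Lemma map_seq_word_S (a r : nat -> nat) (k : nat) :
  map a (seq 1 (block_end r (S k)))
  = map a (seq 1 (block_end r k)) ++ map a (seq (block_end r k + 1) (2 * r (S k) + 2)).
Proof.
  rewrite <- map_app. f_equal. simpl block_end. rewrite <- Nat.add_assoc.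
  rewrite seq_app. do 2 f_equal. lia.
Qed.

Lemma has_form_iff_block_form (a r : nat -> nat) : has_form a r <-> block_form a r.
Proof.
  unfold has_form. split.
  - intro H. split; [specialize (H 0); simpl in H; now injection H|].
    intro i. pose proof (H (S i)) as Hi. specialize (H i).
    rewrite length_word in *. rewrite map_seq_word_S, word_S, H in Hi.
    apply app_inv_head, map_seq_ones_two_two in Hi as [H1 [H2 H3]].
    split; [assumption|]. split; [same_index H2|same_index H3].
  - intros [H0 H] k. induction k as [|k IH].
    + simpl. now rewrite H0.
    + rewrite length_word in *. rewrite map_seq_word_S, word_S, IH. f_equal.
      destruct (H k) as [H1 [H2 H3]].
      apply map_seq_ones_two_two. split; [assumption|].
      split; [same_index H2|same_index H3].
Qed.

(** Start at position 1, a run of one 2, and iterate [next_block]. Choosing the block length as a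
    function of the boundary alone turns the iteration into a recursion. *)
Lemma admissible_block_form (a : nat -> nat) :
  (forall n, 1 <= n -> 1 <= a n) -> 2 <= a 1 ->
  ~ (a 1 = 2 /\ forall n, 2 <= n -> a n = 1) ->
  admissible a -> exists r, block_form a r.
Proof.
  intros Ha Ha1 Hnot Hadm.
  assert (E1 : a 1 = 2) by (destruct (adm_letter a Hadm 1 (le_n 1)); lia).
  assert (Hnext : forall e, exists r, twos_boundary a e ->
    (forall k, k < 2 * r -> a (e + 1 + k) = 1) /\
    a (e + 2 * r + 1) = 2 /\ a (e + 2 * r + 2) = 2 /\
    twos_boundary a (e + 2 * r + 2)).
  { intro e. destruct (classic (twos_boundary a e)) as [He|He].
    - destruct (next_block a Ha Ha1 Hadm e Hnot He) as [r Hr]. now exists r.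
    (* An arbitrary value away from the boundaries makes the choice total. *)
    - exists 0. contradiction. }
  set (f := fun e => proj1_sig (constructive_indefinite_description _ (Hnext e))).
  assert (Hf : forall e, twos_boundary a e ->
    (forall k, k < 2 * f e -> a (e + 1 + k) = 1) /\
    a (e + 2 * f e + 1) = 2 /\ a (e + 2 * f e + 2) = 2 /\
    twos_boundary a (e + 2 * f e + 2)).
  { intro e. exact (proj2_sig (constructive_indefinite_description _ (Hnext e))). }
  clearbody f.
  set (ends := fix ends i := match i with
                             | 0 => 1
                             | S j => ends j + 2 * f (ends j) + 2
                             end).
  exists (fun i => f (ends (i - 1))). set (r := fun i => f (ends (i - 1))).
  assert (Hr : forall i, r (S i) = f (ends i)) by (intro i; unfold r; do 2 f_equal; lia).
  assert (Hends : forall i, block_end r i = ends i).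
  { induction i as [|i IH]; [reflexivity|]. simpl block_end. now rewrite Hr, IH. }
  assert (Hb : forall i, twos_boundary a (ends i)).
  { induction i as [|i IH]; [|now apply Hf].
    exists 0, 1. split; [reflexivity|]. split.
    - intros i Hi. same_index E1.
    - left. split; [reflexivity|]. now exists 0. }
  split; [assumption|]. intro i. rewrite Hr, Hends.
  destruct (Hf _ (Hb i)) as (H1 & H2 & H3 & _). auto.
Qed.

(** * Comparison of block sequences *)

Lemma block_end_S (r : nat -> nat) (i : nat) :
  block_end r (S i) = block_end r i + 2 * r (S i) + 2.
Proof. reflexivity. Qed.

(* Prefixing a continued fraction [0, x] by the letters 1,1 and by the letters 2,2. *)
Definition pre11 (x : R) : R := (/ (1 + / (1 + x)))%R.
Definition pre22 (x : R) : R := (/ (2 + / (2 + x)))%R.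
Definition ones (k : nat) (x : R) : R := Nat.iter k pre11 x.

Lemma pre11_gt_half (x : R) : (0 < x)%R -> (1 / 2 < pre11 x)%R.
Proof.
  intro Hx. unfold pre11. replace (1 / 2)%R with (/ (1 + / 1))%R by lra.
  assert (0 < / (1 + x))%R by (apply Rinv_0_lt_compat; lra).
  apply Rinv_lt_iff; [lra|lra|]. apply Rplus_lt_compat_l, Rinv_lt_iff; lra.
Qed.

Lemma pre11_lt_iff (x y : R) :
  (0 < x)%R -> (0 < y)%R -> (pre11 x < pre11 y <-> x < y)%R.
Proof.
  intros Hx Hy. unfold pre11.
  assert (0 < / (1 + x))%R by (apply Rinv_0_lt_compat; lra).
  assert (0 < / (1 + y))%R by (apply Rinv_0_lt_compat; lra).
  pose proof (Rinv_lt_iff (1 + y) (1 + x) ltac:(lra) ltac:(lra)).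
  rewrite Rinv_lt_iff by lra. lra.
Qed.

Lemma pre22_lt_iff (x y : R) :
  (0 < x)%R -> (0 < y)%R -> (pre22 x < pre22 y <-> x < y)%R.
Proof.
  intros Hx Hy. unfold pre22.
  assert (0 < / (2 + x))%R by (apply Rinv_0_lt_compat; lra).
  assert (0 < / (2 + y))%R by (apply Rinv_0_lt_compat; lra).
  pose proof (Rinv_lt_iff (2 + y) (2 + x) ltac:(lra) ltac:(lra)).
  rewrite Rinv_lt_iff by lra. lra.
Qed.

Lemma ones_pos (k : nat) (x : R) : (0 < x)%R -> (0 < ones k x)%R.
Proof.
  intro Hx. induction k as [|k IH]; [exact Hx|].
  change (ones (S k) x) with (pre11 (ones k x)).
  pose proof (pre11_gt_half _ IH). lra.
Qed.

Lemma ones_lt_iff (k : nat) (x y : R) :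
  (0 < x)%R -> (0 < y)%R -> (ones k x < ones k y <-> x < y)%R.
Proof.
  intros Hx Hy. induction k as [|k IH]; [reflexivity|].
  change (pre11 (ones k x) < pre11 (ones k y) <-> x < y)%R.
  rewrite pre11_lt_iff by now apply ones_pos. exact IH.
Qed.

(** After k common prefixes 1 1, one side is x, at most 1/2, while the other still starts with 1 1
    and exceeds 1/2. *)
Lemma ones_lt_of_lt (k l : nat) (x y : R) :
  (0 < x <= 1 / 2)%R -> (0 < y)%R -> k < l -> (ones k x < ones l y)%R.
Proof.
  intros Hx Hy. revert l; induction k as [|k IH]; intros [|l] Hkl; try lia.
  - change (x < pre11 (ones l y))%R.
    pose proof (pre11_gt_half (ones l y) (ones_pos l y Hy)). lra.
  - change (pre11 (ones k x) < pre11 (ones l y))%R.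
    apply pre11_lt_iff; [apply ones_pos; lra|now apply ones_pos|]. apply IH; lia.
Qed.

Lemma ones_compare (k l : nat) (x y : R) :
  (0 < x <= 1 / 2)%R -> (0 < y <= 1 / 2)%R ->
  (ones k x < ones l y)%R <-> k < l \/ (k = l /\ (x < y)%R).
Proof.
  intros Hx Hy. destruct (lt_eq_lt_dec k l) as [[Hkl| ->]|Hkl].
  - split; [auto|]. intros _. now apply ones_lt_of_lt.
  - rewrite ones_lt_iff by lra. split; [auto|]. intros [?|[_ ?]]; [lia|assumption].
  - split; [|lia]. intro H.
    pose proof (ones_lt_of_lt l k y x Hy ltac:(lra) Hkl). lra.
Qed.

(** Strict lexicographic order of r(p+1), r(p+2), ... above r(q), ..., r(1). A tie down to r(1) does
    not count as domination, in agreement with the initial 2. *)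
Definition dominates (r : nat -> nat) (p q : nat) : Prop :=
  exists j, j < q /\ r (q - j) < r (p + 1 + j) /\
    forall k, k < j -> r (p + 1 + k) = r (q - k).

Lemma dominates_S (r : nat -> nat) (p q : nat) :
  dominates r p (S q) <->
  r (S q) < r (S p) \/ (r (S q) = r (S p) /\ dominates r (S p) q).
Proof.
  split.
  - intros ([|j] & Hj & Hlt & Heq).
    + left. replace (S q - 0) with (S q) in Hlt by lia.
      now replace (p + 1 + 0) with (S p) in Hlt by lia.
    + right. split.
      * specialize (Heq 0 ltac:(lia)). replace (S q - 0) with (S q) in Heq by lia.
        now replace (p + 1 + 0) with (S p) in Heq by lia.
      * exists j. split; [lia|]. split.
        { replace (q - j) with (S q - S j) by lia.
          now replace (S p + 1 + j) with (p + 1 + S j) by lia. }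
        intros k Hk. specialize (Heq (S k) ltac:(lia)).
        replace (q - k) with (S q - S k) by lia.
        now replace (S p + 1 + k) with (p + 1 + S k) by lia.
  - intros [Hlt|[H0 (j & Hj & Hlt & Heq)]].
    + exists 0. split; [lia|]. split; [|lia].
      replace (S q - 0) with (S q) by lia. now replace (p + 1 + 0) with (S p) by lia.
    + exists (S j). split; [lia|]. split.
      { replace (S q - S j) with (q - j) by lia.
        now replace (p + 1 + S j) with (S p + 1 + j) by lia. }
      intros [|k] Hk.
      * replace (S q - 0) with (S q) by lia. now replace (p + 1 + 0) with (S p) by lia.
      * specialize (Heq k ltac:(lia)).
        replace (S q - S k) with (q - k) by lia.
        now replace (p + 1 + S k) with (S p + 1 + k) by lia.
Qed.

(** * Values of the continued fractions in terms of the blocks *)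

Section BlockForm.
Context (a r : nat -> nat) (Ha : forall n, 1 <= n -> 1 <= a n) (Hbf : block_form a r).

Let Ha1 : 2 <= a 1.
Proof. destruct Hbf as [-> _]. lia. Qed.

Lemma head_ones (k q : nat) :
  (forall i, i < 2 * k -> a (q + 1 + i) = 1) ->
  head a (q + 2 * k) = ones k (head a q).
Proof.
  induction k as [|k IH]; intro H.
  - now replace (q + 2 * 0) with q by lia.
  - change (ones (S k) (head a q)) with (pre11 (ones k (head a q))).
    rewrite <- IH by (intros; apply H; lia).
    replace (q + 2 * S k) with (S (S (q + 2 * k))) by lia.
    rewrite !head_S.
    replace (a (S (S (q + 2 * k)))) with 1
      by (symmetry; same_index (H (2 * k + 1) ltac:(lia))).
    replace (a (S (q + 2 * k))) with 1
      by (symmetry; same_index (H (2 * k) ltac:(lia))).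
    reflexivity.
Qed.

Lemma tail_ones (k p : nat) :
  1 <= p -> (forall i, i < 2 * k -> a (p + i) = 1) ->
  tail a p = ones k (tail a (p + 2 * k)).
Proof.
  revert p; induction k as [|k IH]; intros p Hp H.
  - now replace (p + 2 * 0) with p by lia.
  - change (ones (S k) (tail a (p + 2 * S k)))
      with (pre11 (ones k (tail a (p + 2 * S k)))).
    replace (p + 2 * S k) with (p + 2 + 2 * k) by lia.
    rewrite <- IH; [|lia|intros i Hi; same_index (H (S (S i)) ltac:(lia))].
    rewrite (tail_step a Ha p Hp), (tail_step a Ha (S p)) by lia.
    replace (a p) with 1 by (symmetry; same_index (H 0 ltac:(lia))).
    replace (a (S p)) with 1 by (symmetry; same_index (H 1 ltac:(lia))).
    replace (p + 2) with (S (S p)) by lia. reflexivity.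
Qed.

(* [left_value i] reads leftwards from the end of the i-th block 22 (from a_1 when i = 0),
   [right_value (S i)] reads rightwards from the beginning of the (i+1)-st block 22. *)
Definition left_value (i : nat) : R := head a (block_end r i).
Definition right_value (i : nat) : R := tail a (block_end r i - 1).

Lemma block_end_pos (i : nat) : 1 <= block_end r i.
Proof. destruct i; simpl; lia. Qed.

Lemma head_before_22 (i k : nat) :
  k <= r (S i) -> head a (block_end r i + 2 * k) = ones k (left_value i).
Proof.
  intro Hk. apply head_ones. intros j Hj. apply (proj2 Hbf i). lia.
Qed.

Lemma tail_after_22 (i k : nat) :
  k <= r (S i) ->
  tail a (block_end r i + 1 + 2 * k) = ones (r (S i) - k) (right_value (S i)).
Proof.
  intro Hk. rewrite (tail_ones (r (S i) - k)).
  - unfold right_value. do 2 f_equal. rewrite !block_end_S. lia.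
  - lia.
  - intros j Hj. same_index (proj1 (proj2 Hbf i) (2 * k + j) ltac:(lia)).
Qed.

Lemma left_value_S (i : nat) :
  left_value (S i) = pre22 (ones (r (S i)) (left_value i)).
Proof.
  rewrite <- head_before_22 by lia. destruct (proj2 Hbf i) as (_ & E1 & E2).
  unfold left_value. rewrite !block_end_S.
  replace (block_end r i + 2 * r (S i) + 2)
    with (S (S (block_end r i + 2 * r (S i)))) in * by lia.
  replace (block_end r i + 2 * r (S i) + 1)
    with (S (block_end r i + 2 * r (S i))) in * by lia.
  rewrite !head_S, E1, E2. reflexivity.
Qed.

Lemma right_value_S (i : nat) :
  right_value (S i) = pre22 (ones (r (S (S i))) (right_value (S (S i)))).
Proof.
  pose proof (tail_after_22 (S i) 0 ltac:(lia)) as H. rewrite Nat.sub_0_r in H.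
  rewrite <- H. destruct (proj2 Hbf i) as (_ & E1 & E2).
  unfold right_value. rewrite !block_end_S.
  set (e := block_end r i + 2 * r (S i)) in *.
  fold e. replace (e + 2 - 1) with (e + 1) by lia.
  rewrite (tail_step a Ha (e + 1)), E1, (tail_step a Ha (S (e + 1))) by lia.
  replace (S (e + 1)) with (e + 2) by lia. rewrite E2.
  replace (S (e + 2)) with (e + 2 + 1 + 0) by lia. reflexivity.
Qed.

Lemma left_value_0 : left_value 0 = (1 / 2)%R.
Proof.
  unfold left_value. simpl. rewrite (proj1 Hbf). simpl. lra.
Qed.

Lemma left_value_bounds (i : nat) : (0 < left_value i <= 1 / 2)%R.
Proof.
  split; [apply head_bounds_pos; auto using block_end_pos|].
  destruct i as [|i]; [rewrite left_value_0; lra|].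
  unfold left_value. destruct (proj2 Hbf i) as (_ & _ & E).
  rewrite !block_end_S. rewrite Nat.add_succ_r in *. now apply head_le_half.
Qed.

Lemma right_value_bounds (i : nat) : (0 < right_value (S i) < 1 / 2)%R.
Proof.
  pose proof (block_end_pos i). destruct (proj2 Hbf i) as (_ & E & _).
  unfold right_value. rewrite !block_end_S. split.
  - apply tail_bounds; [assumption|lia].
  - apply tail_lt_half; [assumption|assumption|lia|]. same_index E.
Qed.

(** Peel 2 2 and a block of ones from both sides: [pre22] is increasing and [ones_compare] is
    lexicographic. At q = 0 domination is impossible and the left value is exactly 1/2, above every
    right value. Stating two implications also excludes equality. *)
Lemma value_compare (p q : nat) :
  (dominates r (S p) q -> (left_value q < right_value (S p))%R) /\
  (~ dominates r (S p) q -> (right_value (S p) < left_value q)%R).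
Proof.
  revert p; induction q as [|q IH]; intro p.
  - rewrite left_value_0. pose proof (right_value_bounds p). split; [|lra].
    intros (j & Hj & _). lia.
  - rewrite left_value_S, right_value_S.
    pose proof (left_value_bounds q). pose proof (right_value_bounds (S p)).
    rewrite !pre22_lt_iff by (apply ones_pos; lra).
    rewrite !ones_compare by lra. rewrite dominates_S.
    destruct (IH (S p)) as [IH1 IH2].
    destruct (lt_eq_lt_dec (r (S q)) (r (S (S p)))) as [[?|?]|?].
    + split; [auto|tauto].
    + split; [intros [?|[? ?]]; auto|]. intro Hn. right. split; [auto|].
      apply IH2. tauto.
    + split; [lia|auto].
Qed.

Lemma dominates_iff (p q : nat) :
  dominates r (S p) q <-> (left_value q < right_value (S p))%R.
Proof.
  destruct (value_compare p q) as [H1 H2]. split; [assumption|].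
  intro Hlt. apply NNPP. intro Hn. specialize (H2 Hn). lra.
Qed.

Lemma not_dominates_iff (p q : nat) :
  ~ dominates r (S p) q <-> (right_value (S p) < left_value q)%R.
Proof.
  destruct (value_compare p q) as [H1 H2]. split; [assumption|].
  intros Hlt Hd. specialize (H1 Hd). lra.
Qed.

(** The inequality of [adm_right] at the 2 2 after the block r(i+1): the junction uses one pair 1 1
    of the block r(i+2), so r(i+2) - 1 is compared with r(i+1). In [left_cond] the pair is taken
    from r(i+1). *)
Definition right_cond (i : nat) : Prop :=
  r (S (S i)) <= r (S i) + 1 /\
  (r (S (S i)) = r (S i) + 1 -> ~ dominates r (S (S i)) i).

Definition left_cond (i : nat) : Prop :=
  r (S i) <= r (S (S i)) + 1 /\
  (r (S i) = r (S (S i)) + 1 -> dominates r (S (S i)) i).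

Lemma right_cond_iff (i : nat) :
  1 <= r (S (S i)) ->
  (tail a (block_end r i + 2 * r (S i) + 5) < head a (block_end r i + 2 * r (S i)))%R
  <-> right_cond i.
Proof.
  intro Hr. rewrite head_before_22 by lia.
  replace (block_end r i + 2 * r (S i) + 5) with (block_end r (S i) + 1 + 2 * 1)
    by (rewrite !block_end_S; lia).
  rewrite tail_after_22 by lia.
  pose proof (left_value_bounds i). pose proof (right_value_bounds (S i)).
  rewrite ones_compare by lra. rewrite <- not_dominates_iff.
  unfold right_cond. split.
  - intros [?|[? ?]]; split; try lia; auto.
  - intros [Hle Hd]. destruct (Nat.eq_dec (r (S (S i))) (r (S i) + 1)) as [E|E].
    + right. split; [lia|auto].
    + left. lia.
Qed.

Lemma left_cond_iff (i k : nat) :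
  r (S i) = k + 1 ->
  (head a (block_end r i + 2 * k) < tail a (block_end r i + 2 * k + 5))%R
  <-> left_cond i.
Proof.
  intro Hr. rewrite head_before_22 by lia.
  replace (block_end r i + 2 * k + 5) with (block_end r (S i) + 1 + 2 * 0)
    by (rewrite !block_end_S; lia).
  rewrite tail_after_22, Nat.sub_0_r by lia.
  pose proof (left_value_bounds i). pose proof (right_value_bounds (S i)).
  rewrite ones_compare by lra. rewrite <- dominates_iff.
  unfold left_cond. split.
  - intros [?|[? ?]]; split; try lia; auto.
  - intros [Hle Hd]. destruct (Nat.eq_dec (r (S i)) (r (S (S i)) + 1)) as [E|E].
    + right. split; [lia|auto].
    + left. lia.
Qed.

(** Locates an arbitrary junction among the blocks; the induction moves from each kind of position
    to the next. *)
Lemma block_position (n : nat) :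
  1 <= n ->
  n = 1 \/
  exists i, (exists k, k < 2 * r (S i) /\ n = block_end r i + 1 + k) \/
    n = block_end r i + 2 * r (S i) + 1 \/ n = block_end r (S i).
Proof.
  induction n as [|n IH]; intro Hn; [lia|].
  assert (Hnew : forall i, n = block_end r i ->
    S n = 1 \/
    exists i, (exists k, k < 2 * r (S i) /\ S n = block_end r i + 1 + k) \/
      S n = block_end r i + 2 * r (S i) + 1 \/ S n = block_end r (S i)).
  { intros i ->. right. exists i.
    destruct (Nat.eq_dec (r (S i)) 0) as [E|E].
    - right. left. lia.
    - left. exists 0. lia. }
  destruct n as [|n]; [now left|].
  destruct (IH ltac:(lia)) as [E|(i & [(k & Hk & E)|[E|E]])].
  - apply (Hnew 0). exact E.
  - right. exists i. destruct (Nat.eq_dec (k + 1) (2 * r (S i))) as [Ek|Ek].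
    + right. left. lia.
    + left. exists (k + 1). lia.
  - right. exists i. right. right. rewrite !block_end_S. lia.
  - now apply (Hnew (S i)).
Qed.

Lemma admissible_iff_conds :
  admissible a <-> forall i, right_cond i /\ left_cond i.
Proof.
  split.
  - intros Hadm i.
    destruct (proj2 Hbf i) as (H1 & E1 & E2).
    destruct (proj2 Hbf (S i)) as (H1' & _ & _). rewrite block_end_S in H1'. split.
    (* An empty block gives no junction, and the condition is then trivially true. *)
    + destruct (Nat.eq_dec (r (S (S i))) 0) as [E|E]; [split; lia|].
      apply right_cond_iff; [lia|].
      apply (adm_right a Hadm); [assumption|assumption|].
      same_index (H1' 0 ltac:(lia)).
    + destruct (Nat.eq_dec (r (S i)) 0) as [E|E]; [split; lia|].
      apply (left_cond_iff i (r (S i) - 1)); [lia|].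
      apply (adm_left a Hadm).
      * same_index (H1 (2 * r (S i) - 1) ltac:(lia)).
      * same_index E1.
      * same_index E2.
  - intro Hc. destruct Hbf as [E0 Hblock]. split.
    + intros n Hn. destruct (block_position n Hn) as [->|(i & [(k & Hk & ->)|[->| ->]])].
      * now right.
      * left. now apply Hblock.
      * right. apply Hblock.
      * right. apply Hblock.
    + intros n Hn E1 E2.
      destruct (block_position n Hn) as [->|(i & [(k & Hk & ->)|[->| ->]])].
      * lia.
      * destruct (Hblock i) as (H1 & _ & H2).
        destruct (Nat.eq_dec (k + 1) (2 * r (S i))) as [Ek|Ek]; [same_index H2|].
        pose proof (H1 (k + 1) ltac:(lia)).
        replace (block_end r i + 1 + k + 1) with (block_end r i + 1 + (k + 1)) in E2; lia.
      * destruct (Hblock i) as (_ & H1 & _). lia.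
      * destruct (Hblock i) as (_ & _ & H1). rewrite !block_end_S in E1. lia.
    + intros n E1 E2 E3.
      (* The second 2 of 2 2 1 can only be the end of a pair 2 2; the other positions contradict the
         letters. *)
      destruct (block_position (n + 2) ltac:(lia)) as [E|(i & [(k & Hk & E)|[E|E]])].
      * lia.
      * destruct (Hblock i) as (H1 & _ & _). specialize (H1 k Hk).
        rewrite <- E in H1. lia.
      * destruct (Hblock i) as (_ & _ & H1).
        replace (block_end r i + 2 * r (S i) + 2) with (n + 3) in H1 by lia. lia.
      * rewrite !block_end_S in E. destruct (Hblock (S i)) as (H1 & H2 & _).
        rewrite block_end_S in H1, H2.
        destruct (Nat.eq_dec (r (S (S i))) 0) as [Er|Er].
        { rewrite Er in H2.
          replace (block_end r i + 2 * r (S i) + 2 + 2 * 0 + 1) with (n + 3) in H2 by lia.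
          lia. }
        split; [same_index (H1 1 ltac:(lia))|].
        replace n with (block_end r i + 2 * r (S i)) by lia.
        apply right_cond_iff; [lia|apply Hc].
    + intros n E1 E2 E3.
      (* The 1 of 1 2 2 can only be the last letter of a block of ones. *)
      destruct (block_position (n + 2) ltac:(lia)) as [E|(i & [(k & Hk & E)|[E|E]])].
      * lia.
      * destruct (Hblock i) as (H1 & _ & _).
        destruct (Nat.eq_dec (k + 1) (2 * r (S i))) as [Ek|Ek].
        2: { specialize (H1 (k + 1) ltac:(lia)).
             replace (block_end r i + 1 + (k + 1)) with (n + 3) in H1 by lia. lia. }
        split; [same_index (H1 (k - 1) ltac:(lia))|].
        replace n with (block_end r i + 2 * (r (S i) - 1)) by lia.
        apply left_cond_iff; [lia|apply Hc].
      * destruct (Hblock i) as (_ & H1 & _).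
        rewrite <- E in H1. lia.
      * destruct (Hblock i) as (_ & _ & H1). rewrite !block_end_S in E.
        rewrite <- E in H1. lia.
Qed.

End BlockForm.

(** * Translation into conditions (A), (B) and (C01) *)

(** Both sides speak of the first difference of the same two lists; [dominates] counts from 0 and
    [first_nonzero] from 1. *)
Lemma dominates_iff_first_nonzero (r : nat -> nat) (i : nat) :
  dominates r (S (S i)) i <->
  exists j, first_nonzero r (S i) j /\ (diff r (S i + j + 1) (S i - j) > 0)%Z.
Proof.
  unfold first_nonzero, diff. split.
  - intros (j & Hj & Hlt & Heq). exists (S j).
    replace (S i - S j) with (i - j) by lia.
    replace (S i + S j + 1) with (S (S i) + 1 + j) by lia.
    repeat split; try lia. intros k Hk. specialize (Heq (k - 1) ltac:(lia)).
    replace (i - (k - 1)) with (S i - k) in Heq by lia.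
    replace (S (S i) + 1 + (k - 1)) with (S i + k + 1) in Heq by lia. lia.
  - intros (j & (Hj & _ & Heq) & Hlt). exists (j - 1). split; [lia|]. split.
    + replace (i - (j - 1)) with (S i - j) by lia.
      replace (S (S i) + 1 + (j - 1)) with (S i + j + 1) by lia. lia.
    + intros k Hk. specialize (Heq (S k) ltac:(lia)).
      replace (S i - S k) with (i - k) in Heq by lia.
      replace (S i + S k + 1) with (S (S i) + 1 + k) in Heq by lia. lia.
Qed.

Lemma first_nonzero_exists (r : nat -> nat) (i j : nat) :
  1 <= j < i -> diff r (i + j + 1) (i - j) <> 0%Z -> exists k, first_nonzero r i k.
Proof.
  induction j as [j IH] using (well_founded_induction Wf_nat.lt_wf). intros Hj Hd.
  destruct (classic (exists k, 1 <= k < j /\ diff r (i + k + 1) (i - k) <> 0%Z))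
    as [(k & Hk & Hdk)|H].
  - apply (IH k); [lia|lia|assumption].
  - exists j. split; [assumption|]. split; [assumption|]. intros k Hk.
    apply NNPP. intro Hdk. apply H. now exists k.
Qed.

Lemma first_nonzero_unique (r : nat -> nat) (i j k : nat) :
  first_nonzero r i j -> first_nonzero r i k -> j = k.
Proof.
  intros (Hj & Nj & Zj) (Hk & Nk & Zk).
  destruct (lt_eq_lt_dec j k) as [[H|H]|H]; [|assumption|]; exfalso.
  - apply Nj, Zk. lia.
  - apply Nk, Zj. lia.
Qed.

(** (A) collects the two bounds, and (B) fixes the sign of the first difference if there is one. In
    the case -1 domination also needs a difference to exist, which (C01) supplies; in the case +1 a
    complete tie is allowed. *)
Lemma conds_iff (r : nat -> nat) :
  (forall i, right_cond r i /\ left_cond r i) <-> condA r /\ condB r /\ condC01 r.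
Proof.
  unfold right_cond, left_cond. split.
  - intro H. split; [|split; [|split]].
    + intros [|i] Hi; [lia|]. destruct (H i) as [[H1 _] [H2 _]].
      unfold diff. replace (S i + 1) with (S (S i)) by lia. lia.
    + intros [|i] Hi; [lia|]. destruct (H i) as [[_ H1] [_ H2]].
      rewrite dominates_iff_first_nonzero in H1, H2.
      replace (S i + 1) with (S (S i)) by lia. split; intros Hd j Hj.
      * destruct H2 as (k & Hk & Hpos); [unfold diff in Hd; lia|].
        now rewrite (first_nonzero_unique r _ _ _ Hj Hk).
      * destruct (Z.lt_trichotomy (diff r (S i + j + 1) (S i - j)) 0) as [?|[?|?]].
        -- lia.
        -- now destruct (proj1 (proj2 Hj)).
        -- exfalso. apply H1; [unfold diff in Hd; lia|]. exists j. split; [assumption|lia].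
    (* At i = 0 there is nothing to dominate, so r(1) = r(2) + 1 is impossible. *)
    + destruct (H 0) as [_ [H1 H2]].
      destruct (Nat.eq_dec (r 1) (r 2 + 1)) as [E|E]; [|lia].
      destruct (H2 E) as (j & Hj & _). lia.
    + intros [|i] Hi Hd; [lia|]. destruct (H i) as [_ [_ H2]].
      rewrite dominates_iff_first_nonzero in H2. unfold diff in Hd.
      replace (S i + 1) with (S (S i)) in Hd by lia.
      destruct H2 as (j & (Hj & _) & Hpos); [lia|].
      exists j. split; [assumption|]. unfold diff in Hpos. lia.
  - intros (HA & HB & _ & HC) i.
    specialize (HA (S i) ltac:(lia)). specialize (HB (S i) ltac:(lia)).
    specialize (HC (S i) ltac:(lia)).
    replace (S i + 1) with (S (S i)) in * by lia.
    rewrite dominates_iff_first_nonzero. unfold diff in HA.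
    split; (split; [lia|]); intro E.
    + intros (j & Hj & Hpos). destruct HB as [_ HB].
      specialize (HB ltac:(unfold diff; lia) j Hj). lia.
    + destruct HB as [HB _]. specialize (HB ltac:(unfold diff; lia)).
      destruct HC as (j & Hj & Hgt); [unfold diff; lia|].
      destruct (first_nonzero_exists r (S i) j Hj) as [k Hk]; [unfold diff; lia|].
      exists k. auto.
Qed.

Theorem theorem4p1 :
  forall a : nat -> nat,
    (forall n, 1 <= n -> 1 <= a n) ->
    2 <= a 1 ->
    ~ (a 1 = 2 /\ forall n, 2 <= n -> a n = 1) ->
    ((forall n : nat, (mu a n < 3)%R) <->
     (exists r : nat -> nat,
        has_form a r /\ condA r /\ condB r /\ condC01 r)).
Proof.
  intros a Ha Ha1 Hnot. rewrite (lt_3_iff_admissible a Ha Ha1). split.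
  - intro Hadm. destruct (admissible_block_form a Ha Ha1 Hnot Hadm) as [r Hr].
    exists r. split; [now apply has_form_iff_block_form|].
    now apply conds_iff, (admissible_iff_conds a r Ha Hr).
  - intros (r & Hr & Hc). apply has_form_iff_block_form in Hr.
    now apply (admissible_iff_conds a r Ha Hr), conds_iff.
Qed.
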